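(* Let $G$ and $N$ be groups. (1) For $0\le p\le 2$, every $p$-cocycle $(c,L)\in C^p(G,N)$ is integrable. (2) Let $(f,L)$ be a $2$-cocycle and let $\mathcal I=\mathcal I(f,L)\subset N$ be its holonomy group. Then the set $E_{f,L}=\mathcal I\times G$ with the multiplication $$(n_1,g_1)(n_2,g_2)=(n_1L_{g_1}(n_2)f(g_1,g_2),\,g_1g_2)$$ is a group extension of $G$ by the subgroup $\mathcal I$ of $N$ (via $n\mapsto(n,1)$ and $(n,g)\mapsto g$). Moreover, $(f,L)$ is represented by the canonical section $s:G\to E_{f,L}$, $s(g)=(1,g)$: identifying $\mathcal I$ with $\mathcal I\times\{1\}$, one has $L_g(n)=s(g)\,n\,s(g)^{-1}$ for all $g\in G$, $n\in\mathcal I$ (that is, $L=C_s$), and $f(a,b)=s(a)s(b)s(ab)^{-1}$ for all $a,b\in G$ (that is, $f=\delta_Ls$). (3) For a $2$-cocycle $(f,L)$, the associated monoidal category $(\mathcal E_r,\otimes,\tilde\alpha)$ on $E=E_{f,L}=\mathcal I\times G$ is strict, and $s:\mathcal B_G\to\mathcal E_r$ together with the vectors $s(ab)\to s(a)s(b)$ (underlying element $(\delta_L s)(a,b)=f(a,b)$) is a monoidal functor.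
   Context: Cochains. $C^p(G,N)$ is the set of pairs $(c,L)$ where $c:G^p\to N$ is a normalized function (value $1$ if some argument is $1$; for $p=0$, $c$ is an element of $N$) and $L:G\to\mathrm{Aut}(N)$, $g\mapsto L_g$, is a function with $L_1=\mathrm{id}$ ($L$ need not be a homomorphism; it is called a quasiaction). Put - $p=0$: $\partial^+_Ln(a)=L_a(n)$, $\partial^-_Ln(a)=n$; - $p=1$: $\partial^+_Ls(a,b)=L_a(s(b))s(a)$, $\partial^-_Ls(a,b)=s(ab)$; - $p=2$: $\partial^+_Lf(a,b,c)=L_a(f(b,c))f(a,bc)$, $\partial^-_Lf(a,b,c)=f(a,b)f(ab,c)$. $(c,L)$ is a $p$-cocycle if $\partial^+_Lc=\partial^-_Lc$. Put $\delta_Lc=(\partial^+_Lc)(\partial^-_Lc)^{-1}$ (pointwise product). $C_n(x)=nxn^{-1}$. Holonomy group. $\mathcal I(c,L)$ is the subgroup of $N$ generated by all elements $L_{a_1}(L_{a_2}(\cdots L_{a_k}(c(g_1,\dots,g_p))\cdots))$, $k\ge0$, $a_i,g_j\in G$. Integrability. For $(c,L)\in C^p(G,N)$, $0\le p\le2$, put $f=c$ if $p=2$, $f=\delta_Lc$ if $p=1$, $f=\delta_L\delta_Lc$ if $p=0$. $(c,L)$ is integrable if $L_a(L_b(x))=f(a,b)\,L_{ab}(x)\,f(a,b)^{-1}$ for all $a,b\in G$ and $x\in\mathcal I(c,L)$. Monoidal categories. A monoidal category is a triple $(\mathcal C,\otimes,\alpha)$ with $\alpha_{X,Y,Z}:(X\otimes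 Y)\otimes Z\to X\otimes(Y\otimes Z)$ a natural isomorphism satisfying the pentagon axiom (units are not part of the data); it is strict if $\alpha$ is the identity. A monoidal functor is a functor $F$ with a natural isomorphism $\Phi_{X,Y}:F(X\otimes Y)\to F(X)\otimes F(Y)$ such that $(\mathrm{id}_{F(X)}\otimes\Phi_{Y,Z})\,\Phi_{X,Y\otimes Z}\,F(\alpha_{X,Y,Z})=\alpha_{F(X),F(Y),F(Z)}\,(\Phi_{X,Y}\otimes\mathrm{id}_{F(Z)})\,\Phi_{X\otimes Y,Z}$. The category $\mathcal E_r$ on $E=\mathcal I\times G$ (where $(f,L)$ is a $2$-cocycle and $\mathcal I=\mathcal I(f,L)$) with the multiplication $(n_1,g_1)(n_2,g_2)=(n_1L_{g_1}(n_2)f(g_1,g_2),\,g_1g_2)$ for $n_1,n_2\in\mathcal I$, $g_1,g_2\in G$: objects are the elements of $E$; there is exactly one morphism $(n_1,g)\to(n_2,g)$, called a vector, with underlying element $n_2n_1^{-1}\in\mathcal I$, and there are no morphisms between objects with different $G$-components; composition is multiplication of underlying elements. $\otimes$ is the multiplication of $E$ on objects, and on morphisms the product of a vector $(n_1,g)\to(n_2,g)$ and a vector $e\to e'$ with underlying element $n$ is the vector $(n_1,g)e\to(n_2,g)e'$, with underlying element $n_2L_g(n)n_1^{-1}$. $\tilde\alpha_{e_1,e_2,e_3}$ is the unique vector $(e_1e_2)e_3\to e_1(e_2e_3)$. $\mathcal B_G$ is the strict monoidal category with objects the elements of $G$, only identity morphisms, and $\otimes$ the multiplication of $G$. *)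

(* Defs.v *)
From HB Require Import structures.
From mathcomp Require Import all_boot all_classical.

Set Implicit Arguments.
Unset Strict Implicit.
Unset Printing Implicit Defensive.

Local Open Scope group_scope.

Record automorphism (N : groupType) := Automorphism {
  aut_fun :> {multiplicative N -> N};
  aut_bij : bijective aut_fun }.

Record cochain (G N : groupType) (p : nat) := Cochain {
  cfun :> p.-tuple G -> N;
  qact : G -> automorphism N;
  cfun_normalized : forall t : p.-tuple G, 1 \in (t : seq G) -> cfun t = 1;
  qact1 : forall x : N, qact 1 x = x }.

(* The operators are only meaningful for p <= 2; for larger p they take the
   dummy value 1. The entries of a tuple t are t`_0, t`_1, ... *)
Definition dplus (G N : groupType) (L : G -> N -> N) (p : nat) :
    (p.-tuple G -> N) -> p.+1.-tuple G -> N :=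
  match p with
  | 0 => fun n t => L t`_0 (n [tuple])
  | 1 => fun s t => L t`_0 (s [tuple t`_1]) * s [tuple t`_0]
  | 2 => fun f t => L t`_0 (f [tuple t`_1; t`_2]) * f [tuple t`_0; t`_1 * t`_2]
  | _ => fun _ _ => 1
  end.

Definition dminus (G N : groupType) (p : nat) :
    (p.-tuple G -> N) -> p.+1.-tuple G -> N :=
  match p with
  | 0 => fun n _ => n [tuple]
  | 1 => fun s t => s [tuple t`_0 * t`_1]
  | 2 => fun f t => f [tuple t`_0; t`_1] * f [tuple t`_0 * t`_1; t`_2]
  | _ => fun _ _ => 1
  end.

Definition delta (G N : groupType) (L : G -> N -> N) (p : nat)
    (c : p.-tuple G -> N) (t : p.+1.-tuple G) : N :=
  dplus L c t / dminus c t.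

Definition is_cocycle (G N : groupType) (p : nat) (c : cochain G N p) : Prop :=
  forall t : p.+1.-tuple G, dplus (qact c) c t = dminus c t.

Section Holonomy.
Variables (G N : groupType) (p : nat) (c : cochain G N p).

Definition holonomy_gen : set N :=
  [set x | exists (a : seq G) (t : p.-tuple G),
             x = foldr (fun g y => qact c g y) (c t) a]%classic.

Definition holonomy : set N :=
  smallest (fun H : set N => group_closed (mem H)) holonomy_gen.

Lemma holonomy_closed : group_closed (mem holonomy).
Proof.
split; first by apply/mem_set => H [[H1 _] _]; exact: set_mem.
move=> x y /set_mem xI /set_mem yI; apply/mem_set => H HH.
by apply/set_mem/HH.1.2; apply/mem_set; [exact: xI | exact: yI].
Qed.

Definition hol : Type := set_type holonomy.
HB.instance Definition _ := SubChoice.copy hol (set_type holonomy).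
HB.instance Definition _ :=
  SubChoice_isSubGroup.Build N (mem holonomy) hol holonomy_closed.

Lemma holonomy_cfun (t : p.-tuple G) : c t \in holonomy.
Proof. by apply/mem_set => H [_]; apply; exists [::]; exists t. Qed.

Lemma holonomy_qact (g : G) (x : N) :
  x \in holonomy -> qact c g x \in holonomy.
Proof.
have q1 : qact c g 1 = 1 by apply: (@mulgI _ (qact c g 1)); rewrite -gmulfM !mulg1.
have qV y : qact c g y^-1 = (qact c g y)^-1.
  by apply: (@mulgI _ (qact c g y)); rewrite -gmulfM !mulgV.
move=> /set_mem xI; apply/mem_set => H [HH genH].
suff : [set y | qact c g y \in H]%classic x by exact: set_mem.
apply: xI; split; last first.
  by move=> _ [a [t ->]]; apply/mem_set/genH; exists (g :: a); exists t.
split; first by apply/mem_set; rewrite /= q1; exact: HH.1.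
move=> y z /set_mem yH /set_mem zH; apply/mem_set => /=.
by rewrite gmulfM qV; exact: HH.2.
Qed.

Definition hol_cfun (t : p.-tuple G) : hol := Sub (c t) (holonomy_cfun t).
Definition hol_qact (g : G) (n : hol) : hol :=
  Sub (qact c g (val n)) (holonomy_qact g (valP n)).

End Holonomy.

Definition curvature (G N : groupType) (p : nat) (L : G -> N -> N) :
    (p.-tuple G -> N) -> 2.-tuple G -> N :=
  match p with
  | 0 => fun c => delta L (delta L c)
  | 1 => fun c => delta L c
  | 2 => fun c => c
  | _ => fun _ _ => 1
  end.

Definition integrable (G N : groupType) (p : nat) (c : cochain G N p) : Prop :=
  let L := qact c in
  forall (a b : G) (x : N), x \in holonomy c ->
    L a (L b x) = curvature L c [tuple a; b] * L (a * b) x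
                  / curvature L c [tuple a; b].

Definition is_group (T : Type) (mul : T -> T -> T) (e : T) (inv : T -> T) :
    Prop :=
  [/\ associative mul, left_id e mul, right_id e mul, left_inverse e inv mul
    & right_inverse e inv mul].

Definition is_group_extension (K Q : groupType) (T : Type)
    (mul : T -> T -> T) (e : T) (inv : T -> T) (i : K -> T) (p : T -> Q) :
    Prop :=
  [/\ is_group mul e inv,
      {morph i : x y / x * y >-> mul x y} /\ injective i,
      {morph p : x y / mul x y >-> x * y},
      forall q : Q, exists x : T, p x = q
    & forall x : T, p x = 1 <-> exists k : K, i k = x].

(* As a plain set, E = I x G. Its multiplication is ext_mul, not the
   componentwise one that the library puts on a product of groups. *)
Section Extension.
Variables (G N : groupType) (f : cochain G N 2).

Definition ext : Type := (hol f * G)%type.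

Definition ext_mul (x y : ext) : ext :=
  (x.1 * hol_qact x.2 y.1 * hol_cfun f [tuple x.2; y.2], x.2 * y.2).

Definition ext_incl (n : hol f) : ext := (n, 1).
Definition ext_proj (x : ext) : G := x.2.
Definition ext_sec (g : G) : ext := (1, g).

End Extension.

(* Structure and axioms are kept apart: monoidal_data has only the operations,
   is_monoidal_category the axioms. comp v u is "v after u". *)
Record monoidal_data := MonoidalData {
  ob :> Type;
  hom : ob -> ob -> Type;
  idm : forall X, hom X X;
  comp : forall X Y Z, hom Y Z -> hom X Y -> hom X Z;
  tens : ob -> ob -> ob;
  tensm : forall X X' Y Y', hom X X' -> hom Y Y' -> hom (tens X Y) (tens X' Y');
  assoc : forall X Y Z, hom (tens (tens X Y) Z) (tens X (tens Y Z)) }.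

Arguments idm {m} X.
Arguments comp {m X Y Z} v u.
Arguments tens {m} X Y.
Arguments tensm {m X X' Y Y'} u v.
Arguments assoc {m} X Y Z.

Definition is_iso (C : monoidal_data) (X Y : C) (u : hom X Y) : Prop :=
  exists v : hom Y X, comp v u = idm X /\ comp u v = idm Y.

Record is_monoidal_category (C : monoidal_data) : Prop := IsMonoidalCategory {
  comp_id_l : forall (X Y : C) (u : hom X Y), comp (idm Y) u = u;
  comp_id_r : forall (X Y : C) (u : hom X Y), comp u (idm X) = u;
  comp_assoc : forall (X Y Z W : C) (w : hom Z W) (v : hom Y Z) (u : hom X Y),
    comp w (comp v u) = comp (comp w v) u;
  tensm_id : forall X Y : C, tensm (idm X) (idm Y) = idm (tens X Y);
  tensm_comp : forall (X X' X'' Y Y' Y'' : C) (u' : hom X' X'') (u : hom X X')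
      (v' : hom Y' Y'') (v : hom Y Y'),
    tensm (comp u' u) (comp v' v) = comp (tensm u' v') (tensm u v);
  assoc_nat : forall (X X' Y Y' Z Z' : C)
      (u : hom X X') (v : hom Y Y') (w : hom Z Z'),
    comp (assoc X' Y' Z') (tensm (tensm u v) w) =
    comp (tensm u (tensm v w)) (assoc X Y Z);
  assoc_iso : forall X Y Z : C, is_iso (assoc X Y Z);
  pentagon : forall W X Y Z : C,
    comp (tensm (idm W) (assoc X Y Z))
         (comp (assoc W (tens X Y) Z) (tensm (assoc W X Y) (idm Z))) =
    comp (assoc W X (tens Y Z)) (assoc (tens W X) Y Z) }.

(* Identity morphisms, with source and target only propositionally equal:
   is_identity u holds iff X = Y and u is idm X transported along X = Y. *)
Inductive is_identity (C : monoidal_data) : forall X Y : C, hom X Y -> Prop :=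
  IsIdentity X : is_identity (idm X).

Definition is_strict (C : monoidal_data) : Prop :=
  forall X Y Z : C, is_identity (assoc X Y Z).

Record is_monoidal_functor (C D : monoidal_data) (F : C -> D)
    (Fm : forall X Y : C, hom X Y -> hom (F X) (F Y))
    (Phi : forall X Y : C, hom (F (tens X Y)) (tens (F X) (F Y))) : Prop :=
  IsMonoidalFunctor {
  functor_id : forall X : C, Fm _ _ (idm X) = idm (F X);
  functor_comp : forall (X Y Z : C) (v : hom Y Z) (u : hom X Y),
    Fm _ _ (comp v u) = comp (Fm _ _ v) (Fm _ _ u);
  functor_phi_nat : forall (X X' Y Y' : C) (u : hom X X') (v : hom Y Y'),
    comp (Phi X' Y') (Fm _ _ (tensm u v)) =
    comp (tensm (Fm _ _ u) (Fm _ _ v)) (Phi X Y);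
  functor_phi_iso : forall X Y : C, is_iso (Phi X Y);
  functor_phi_assoc : forall X Y Z : C,
    comp (tensm (idm (F X)) (Phi Y Z))
         (comp (Phi X (tens Y Z)) (Fm _ _ (assoc X Y Z))) =
    comp (assoc (F X) (F Y) (F Z))
         (comp (tensm (Phi X Y) (idm (F Z))) (Phi (tens X Y) Z)) }.

(* The only morphisms are identities, so a morphism a -> b is a proof of
   a = b; such proofs are unique as G has decidable equality. *)
Definition BG (G : groupType) : monoidal_data :=
  @MonoidalData G (fun a b => a = b) (fun a => erefl a)
    (fun a b c (v : b = c) (u : a = b) => etrans u v)
    (fun a b => a * b)
    (fun a a' b b' (u : a = a') (v : b = b') => f_equal2 _ u v)
    (fun a b c => esym (mulgA a b c)).

Lemma BG_monoidal (G : groupType) : is_monoidal_category (BG G).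
Proof.
split=> *; try exact: eq_irrelevance.
match goal with |- is_iso (assoc ?x ?y ?z) => exists (mulgA x y z) end.
by split; exact: eq_irrelevance.
Qed.

Lemma BG_strict (G : groupType) : is_strict (BG G).
Proof.
move=> a b c; change (is_identity (C := BG G) (esym (mulgA a b c))).
by case: _ / (esym (mulgA a b c)); exact: (IsIdentity (C := BG G)).
Qed.

Section Er.
Variables (G N : groupType) (f : cochain G N 2).
Implicit Types x y z : ext f.

(* A vector x -> y is its underlying element, which has to be y.1 * x.1^-1. *)
Definition vector x y : Type :=
  {n : hol f | (x.2 == y.2) && (n == y.1 / x.1)}.

Definition underlying x y (v : vector x y) : hol f := val v.

Lemma vect_subproof x y : x.2 = y.2 ->
  (x.2 == y.2) && (y.1 / x.1 == y.1 / x.1).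
Proof. by move=> ->; rewrite !eqxx. Qed.

Definition vect x y (h : x.2 = y.2) : vector x y :=
  exist _ (y.1 / x.1) (vect_subproof h).

Lemma vcomp_subproof x y z (v : vector y z) (u : vector x y) :
  (x.2 == z.2) && (underlying v * underlying u == z.1 / x.1).
Proof.
have /andP[/eqP yz /eqP vE] := valP v; have /andP[/eqP xy /eqP uE] := valP u.
by rewrite /underlying vE uE xy yz eqxx mulgA mulgVK /=.
Qed.

Definition vcomp x y z (v : vector y z) (u : vector x y) : vector x z :=
  exist _ (underlying v * underlying u) (vcomp_subproof v u).

Lemma vtens_subproof x x' y y' (u : vector x x') (v : vector y y') :
  ((ext_mul x y).2 == (ext_mul x' y').2) &&
  (x'.1 * hol_qact x.2 (underlying v) / x.1
     == (ext_mul x' y').1 / (ext_mul x y).1).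
Proof.
have /andP[/eqP xx' _] := valP u; have /andP[/eqP yy' /eqP vE] := valP v.
rewrite /underlying vE /= xx' yy' eqxx /=; apply/eqP.
suff -> : hol_qact x'.2 (y'.1 / y.1) = hol_qact x'.2 y'.1 / hol_qact x'.2 y.1.
  by rewrite !invgM !mulgA mulgK.
apply: (@mulIg _ (hol_qact x'.2 y.1)); rewrite mulgVK.
by apply: val_inj; rewrite valM !SubK -gmulfM mulgVK.
Qed.

Definition vtens x x' y y' (u : vector x x') (v : vector y y') :
    vector (ext_mul x y) (ext_mul x' y') :=
  exist _ (x'.1 * hol_qact x.2 (underlying v) / x.1) (vtens_subproof u v).

Definition Er : monoidal_data :=
  @MonoidalData (ext f) vector (fun x => vect (erefl x.2)) vcomp
    (@ext_mul G N f) vtens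
    (fun x y z =>
       @vect (ext_mul (ext_mul x y) z) (ext_mul x (ext_mul y z))
             (esym (mulgA x.2 y.2 z.2))).

Definition sec_hom (a b : BG G) (e : hom a b) :
    @hom Er (ext_sec f a) (ext_sec f b) :=
  @vect (ext_sec f a) (ext_sec f b) e.

Definition sec_Phi (a b : BG G) :
    @hom Er (ext_sec f (a * b)) (ext_mul (ext_sec f a) (ext_sec f b)) :=
  @vect (ext_sec f (a * b)) (ext_mul (ext_sec f a) (ext_sec f b)) (erefl (a * b)).

End Er.

(* Main.v *)
Require Import Defs.
From mathcomp Require Import all_boot all_classical.

(** The computation behind the three claims is that a 2-cocycle determines
    how L acts on the values of $f$: the cocycle identity reads
      L_a (f(b,c)) = f(a,b) f(ab,c) f(a,bc)^-1,
    and the analogues for p = 0 and p = 1 are L_a n = n and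
    L_a (s(b)) = s(ab) s(a)^-1.  This has two consequences.

    First, L_a maps the values of c into the subgroup that they generate, so
    this subgroup is already L-stable and equals the holonomy group
    ([holonomy_min]).  Second, applying the identity twice to a value f(c,d)
    gives a telescoping product, which yields
      L_a (L_b (x)) = f(a,b) L_{ab}(x) f(a,b)^-1      for x = f(c,d).
    Both sides are multiplicative in x, so they agree on the subgroup
    generated by the values, which is the holonomy group
    ([integrable_of_values]).

    Integrability is what the classical construction of a group extension from
    a factor set uses: the product of I x G is associative by the cocycle
    identity together with integrability on I, and the left inverse of (n, g)
    is found by solving the equation (m, g^-1)(n, g) = (1, 1).  The relations
    L = C_s and f = delta s are the equalities s(g) n = L_g(n) s(g) and
    s(a) s(b) = f(a,b) s(ab) solved for their first factor.

    In E_r there is at most one morphism between two objects, so every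
    equation between morphisms holds, and every morphism is invertible.
    The remaining content of the third claim is that the source and the target
    of the associator are the same object, which is associativity in E. *)

Local Open Scope group_scope.

(** * Subgroups given by morphisms *)

Section MultiplicativeMaps.
Context {N : groupType}.
Implicit Types (phi psi : N -> N) (H : set N).

Lemma morph_mul1 phi : {morph phi : x y / x * y} -> phi 1 = 1.
Proof. by move=> phiM; apply: (@mulgI _ (phi 1)); rewrite -phiM !mulg1. Qed.

Lemma morph_mulV phi : {morph phi : x y / x * y} -> {morph phi : x / x^-1}.
Proof.
move=> phiM x; apply: (@mulgI _ (phi x)).
by rewrite -phiM !mulgV morph_mul1.
Qed.

Lemma equalizer_group_closed phi psi :
    {morph phi : x y / x * y} -> {morph psi : x y / x * y} ->
  group_closed (mem [set x | phi x = psi x]%classic).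
Proof.
move=> phiM psiM; split; first by apply/mem_set; rewrite /= !morph_mul1.
move=> x y /set_mem /= xE /set_mem /= yE; apply/mem_set => /=.
by rewrite phiM psiM !(morph_mulV phi, morph_mulV psi) // xE yE.
Qed.

Lemma preimage_group_closed phi H :
    {morph phi : x y / x * y} -> group_closed (mem H) ->
  group_closed (mem [set x | phi x \in H]%classic).
Proof.
move=> phiM [H1 HV]; split; first by apply/mem_set; rewrite /= morph_mul1.
move=> x y /set_mem /= xH /set_mem /= yH; apply/mem_set => /=.
by rewrite phiM (morph_mulV phi) //; exact: HV.
Qed.

Lemma smallest_group_closed (A : set N) :
  group_closed
    (mem (smallest (fun H : set N => group_closed (mem H)) A)).
Proof.
split=> [|x y /set_mem xS /set_mem yS]; apply/mem_set => H [Hgrp AH].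
  exact: set_mem Hgrp.1.
by apply/set_mem/Hgrp.2; apply/mem_set; [exact: xS | exact: yS].
Qed.

End MultiplicativeMaps.

(** * Integrability of cocycles *)

Section Integrability.
Context {G N : groupType}.

Lemma qactM {p} (c : cochain G N p) a : {morph qact c a : x y / x * y}.
Proof. by move=> x y; rewrite gmulfM. Qed.

Lemma qact_1 {p} (c : cochain G N p) a : qact c a 1 = 1.
Proof. exact/morph_mul1/qactM. Qed.

Lemma qactV {p} (c : cochain G N p) a : {morph qact c a : x / x^-1}.
Proof. exact/morph_mulV/qactM. Qed.

(** The hypothesis on [K] says that the subgroup generated by the values of the
    cochain is stable under the quasiaction; that subgroup then contains
    all the generators of the holonomy group, which are obtained from values by
    iterating the quasiaction. *)
Lemma holonomy_min {p} (c : cochain G N p) (H : set N) :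
    (forall K : set N, group_closed (mem K) -> (forall t, c t \in K) ->
       forall a t, qact c a (c t) \in K) ->
    group_closed (mem H) -> (forall t, c t \in H) ->
  forall x, x \in holonomy c -> x \in H.
Proof.
move=> stable Hgrp Hval x /set_mem xI.
pose V := smallest (fun H : set N => group_closed (mem H))
  [set y | exists t, y = c t]%classic.
have Vgrp : group_closed (mem V) by exact: smallest_group_closed.
have Vval t : c t \in V by apply/mem_set => K [_]; apply; exists t.
have Vmin (K : set N) :
    group_closed (mem K) -> (forall t, c t \in K) -> forall y, y \in V -> y \in K.
  move=> Kgrp Kval y /set_mem yV; apply/mem_set; apply: yV; split=> //.
  by move=> _ [t ->]; exact: set_mem.
have Vact a y : y \in V -> qact c a y \in V.
  move=> yV; apply: (set_mem (Vmin [set z | qact c a z \in V]%classic _ _ _ yV)).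
    by apply: preimage_group_closed => //; exact: qactM.
  by move=> t; apply/mem_set/stable.
apply: (Vmin H) => //; apply/mem_set; apply: xI; split=> // _ [a [t ->]].
by apply: set_mem; elim: a => //= g a; exact: Vact.
Qed.

(** Both sides of the integrability identity are multiplicative in x, so it
    suffices to check it on generators, which can be taken to be values. *)
Lemma integrable_of_values {p} (c : cochain G N p) :
    (forall K : set N, group_closed (mem K) -> (forall t, c t \in K) ->
       forall a t, qact c a (c t) \in K) ->
    (forall a b t, qact c a (qact c b (c t)) =
       curvature (qact c) c [tuple a; b] * qact c (a * b) (c t)
         / curvature (qact c) c [tuple a; b]) ->
  integrable c.
Proof.
move=> stable valE L a b x xI; set k := curvature _ _ _.
apply: (set_mem (A := [set x | L a (L b x) = k * L (a * b) x / k]%classic)).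
apply: holonomy_min xI => // [|t]; last exact/mem_set/valE.
apply: equalizer_group_closed => y z; first by rewrite !qactM.
by rewrite qactM !mulgA mulgVK.
Qed.

Lemma cocycle0E (c : cochain G N 0) a t : is_cocycle c -> qact c a (c t) = c t.
Proof. by move=> /(_ [tuple a]); rewrite (tuple0 t) /= (tuple0 [tuple]). Qed.

Lemma cocycle1E (c : cochain G N 1) a b : is_cocycle c ->
  qact c a (c [tuple b]) = c [tuple a * b] / c [tuple a].
Proof. by move=> /(_ [tuple a; b]) /= <-; rewrite mulgK. Qed.

Lemma cocycle2E (c : cochain G N 2) a b d : is_cocycle c ->
  qact c a (c [tuple b; d]) =
    c [tuple a; b] * c [tuple a * b; d] / c [tuple a; b * d].
Proof. by move=> /(_ [tuple a; b; d]) /= <-; rewrite mulgK. Qed.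

Lemma cocycle0_integrable (c : cochain G N 0) : is_cocycle c -> integrable c.
Proof.
move=> cZ; apply: integrable_of_values => [K _ Kval a t|a b t].
  by rewrite cocycle0E.
by rewrite /= /delta /= !cocycle0E // !(mulgV, qact_1, invg1, mulg1, mul1g).
Qed.

Lemma cocycle1_integrable (c : cochain G N 1) : is_cocycle c -> integrable c.
Proof.
move=> cZ; apply: integrable_of_values => [K [_ KV] Kval a t|a b t].
  by case/tupleP: t => d t; rewrite (tuple0 t) cocycle1E //; exact: KV.
case/tupleP: t => d t; rewrite (tuple0 t) /= /delta cZ mulgV invg1 mulg1 mul1g.
rewrite !cocycle1E // qactM qactV !cocycle1E // invgM invgK.
by rewrite !mulgA mulgVK.
Qed.

Lemma cocycle2_integrable (c : cochain G N 2) : is_cocycle c -> integrable c.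
Proof.
move=> cZ; apply: integrable_of_values => [K Kgrp Kval a t|a b t].
  case/tupleP: t => d t; case/tupleP: t => e t; rewrite (tuple0 t) cocycle2E //.
  by apply: Kgrp.2 => //; exact: group_closedM.
case/tupleP: t => d t; case/tupleP: t => e t; rewrite (tuple0 t) /=.
(* The cocycle identity turns both sides into telescoping products, equal to
   c(a,b) c(ab,d) c(abd,e) c(ab,de)^-1 c(a,b)^-1. *)
rewrite !cocycle2E // !qactM qactV !cocycle2E //.
by rewrite !(invgM, invgK, mulgA) !mulgVK.
Qed.

Lemma cocycle_integrable p (c : cochain G N p) :
  (p <= 2)%N -> is_cocycle c -> integrable c.
Proof.
case: p c => [|[|[|//]]] c _.
- exact: cocycle0_integrable.
- exact: cocycle1_integrable.
- exact: cocycle2_integrable.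
Qed.

End Integrability.

(** * The group extension of a 2-cocycle *)

Section ExtensionGroup.
Context {G N : groupType}.
Variable f : cochain G N 2.
Implicit Types (x y z : ext f) (m n : hol f).

Lemma hol_qactM a : {morph @hol_qact G N 2 f a : m n / m * n}.
Proof. by move=> m n; apply: val_inj; rewrite valM !SubK qactM. Qed.

Lemma hol_qact_1 a : hol_qact a (1 : hol f) = 1.
Proof. exact/morph_mul1/hol_qactM. Qed.

Lemma hol_qact1 n : hol_qact 1 n = n.
Proof. by apply: val_inj; rewrite SubK qact1. Qed.

Lemma hol_cfun1l a : hol_cfun f [tuple 1; a] = 1.
Proof. by apply: val_inj; rewrite SubK cfun_normalized // inE eqxx. Qed.

Lemma hol_cfun1r a : hol_cfun f [tuple a; 1] = 1.
Proof. by apply: val_inj; rewrite SubK cfun_normalized // !inE eqxx orbT. Qed.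

Lemma ext_mul1x : left_id ((1, 1) : ext f) (@ext_mul G N f).
Proof. by case=> n a; rewrite /ext_mul /= hol_qact1 hol_cfun1l mulg1 !mul1g. Qed.

Lemma ext_mulx1 : right_id ((1, 1) : ext f) (@ext_mul G N f).
Proof. by case=> n a; rewrite /ext_mul /= hol_qact_1 hol_cfun1r !mulg1. Qed.

(** The first component comes from solving (m, g^-1)(n, g) = (1, 1) for m. *)
Definition ext_inv x : ext f :=
  ((hol_qact x.2^-1 x.1 * hol_cfun f [tuple x.2^-1; x.2])^-1, x.2^-1).

Lemma ext_mulVx : left_inverse ((1, 1) : ext f) ext_inv (@ext_mul G N f).
Proof. by case=> n a; rewrite /ext_mul /ext_inv /= -mulgA !mulVg. Qed.

Lemma ext_inclM : {morph @ext_incl G N f : m n / m * n >-> ext_mul m n}.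
Proof.
by move=> m n; rewrite /ext_incl /ext_mul /= hol_qact1 hol_cfun1l !mulg1.
Qed.

Lemma ext_proj_kernel x : ext_proj x = 1 <-> exists n, ext_incl n = x.
Proof.
split=> [|[n <-] //]; case: x => n a; rewrite /ext_proj /= => ->.
by exists n.
Qed.

Lemma ext_incl_sec n g : ext_mul (ext_incl n) (ext_sec f g) = (n, g).
Proof.
by rewrite /ext_mul /= hol_qact_1 hol_cfun1l !mulg1 mul1g.
Qed.

Lemma ext_sec_incl g n : ext_mul (ext_sec f g) (ext_incl n) = (hol_qact g n, g).
Proof. by rewrite /ext_mul /= hol_cfun1r !mulg1 mul1g. Qed.

Lemma ext_sec_sec a b :
  ext_mul (ext_sec f a) (ext_sec f b) = (hol_cfun f [tuple a; b], a * b).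
Proof. by rewrite /ext_mul /= hol_qact_1 !mul1g. Qed.

Hypothesis fZ : is_cocycle f.

Lemma hol_cocycle a b c :
  hol_qact a (hol_cfun f [tuple b; c]) * hol_cfun f [tuple a; b * c] =
  hol_cfun f [tuple a; b] * hol_cfun f [tuple a * b; c].
Proof. by apply: val_inj; rewrite !valM !SubK; exact: (fZ [tuple a; b; c]). Qed.

(** Integrability is only known on the holonomy group, which is why the
    extension has that group, and not all of N, as its kernel. *)
Lemma hol_integrable a b n :
  hol_qact a (hol_qact b n) * hol_cfun f [tuple a; b] =
  hol_cfun f [tuple a; b] * hol_qact (a * b) n.
Proof.
apply: val_inj; rewrite !valM !SubK.
by rewrite (cocycle2_integrable _ fZ) /= ?mulgVK //; exact: valP.
Qed.

Lemma ext_mulA : associative (@ext_mul G N f).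
Proof.
case=> n1 a [n2 b] [n3 c]; rewrite /ext_mul /= mulgA; congr (_, _).
rewrite !hol_qactM -!mulgA; congr (_ * (_ * _)).
by rewrite hol_cocycle [LHS]mulgA hol_integrable -mulgA.
Qed.

(** A left inverse is a right inverse, by the usual argument for semigroups
    with a left unit and left inverses. *)
Lemma ext_mulxV : right_inverse ((1, 1) : ext f) ext_inv (@ext_mul G N f).
Proof.
move=> x; rewrite -[LHS]ext_mul1x -{1}(ext_mulVx (ext_inv x)).
by rewrite -ext_mulA [X in ext_mul _ X]ext_mulA ext_mulVx ext_mul1x ext_mulVx.
Qed.

Lemma ext_is_group_extension :
  is_group_extension (@ext_mul G N f) (1, 1) ext_inv
    (@ext_incl G N f) (@ext_proj G N f).
Proof.
split.
- split; [exact: ext_mulA | exact: ext_mul1x | exact: ext_mulx1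
         | exact: ext_mulVx | exact: ext_mulxV].
- by split=> [|m n []]; first exact: ext_inclM.
- by [].
- by move=> g; exists (ext_sec f g).
- exact: ext_proj_kernel.
Qed.

Lemma ext_mul_invr x y z : ext_mul x y = z -> x = ext_mul z (ext_inv y).
Proof. by move=> <-; rewrite -ext_mulA ext_mulxV ext_mulx1. Qed.

Lemma ext_sec_conj g n :
  ext_incl (hol_qact g n) =
  ext_mul (ext_mul (ext_sec f g) (ext_incl n)) (ext_inv (ext_sec f g)).
Proof. by apply: ext_mul_invr; rewrite ext_incl_sec ext_sec_incl. Qed.

Lemma ext_sec_delta a b :
  ext_incl (hol_cfun f [tuple a; b]) =
  ext_mul (ext_mul (ext_sec f a) (ext_sec f b)) (ext_inv (ext_sec f (a * b))).
Proof. by apply: ext_mul_invr; rewrite ext_incl_sec ext_sec_sec. Qed.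

End ExtensionGroup.

(** * The monoidal category of vectors *)

Section Vectors.
Context {G N : groupType}.
Variable f : cochain G N 2.
Implicit Types x y : ext f.

(** The underlying element of a vector is determined by its endpoints. Hence
    functoriality, naturality, the pentagon and the coherence of the section
    all hold because both sides are parallel morphisms. *)
Lemma vector_irrelevance x y (u v : vector x y) : u = v.
Proof.
apply: val_inj.
by have /andP[_ /eqP ->] := valP u; have /andP[_ /eqP ->] := valP v.
Qed.

Lemma Er_iso (X Y : Er f) (u : hom X Y) : is_iso u.
Proof.
have /andP[/eqP XY _] := valP u; exists (vect (esym XY)).
by split; exact: vector_irrelevance.
Qed.

Lemma Er_monoidal : is_monoidal_category (Er f).
Proof.
split=> *; try exact: vector_irrelevance.
exact: Er_iso.
Qed.

(** Strictness compares objects that are equal only by a proof. With an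
    arbitrary pair of equal objects in place of the two bracketings, that proof
    can be eliminated, and uniqueness of morphisms applies. *)
Lemma Er_endo_identity (X Y : Er f) (u : hom X Y) : X = Y -> is_identity u.
Proof.
move=> XY; case: _ / XY u => u.
by rewrite (vector_irrelevance X X u (idm X)); exact: IsIdentity.
Qed.

Lemma Er_strict : is_cocycle f -> is_strict (Er f).
Proof. by move=> fZ X Y Z; apply/Er_endo_identity/esym/ext_mulA. Qed.

Lemma sec_monoidal_functor :
  is_monoidal_functor (C := BG G) (D := Er f) (F := ext_sec f)
    (@sec_hom G N f) (@sec_Phi G N f).
Proof.
split=> *; try exact: vector_irrelevance.
exact: Er_iso.
Qed.

Lemma sec_Phi_underlying a b :
  underlying (sec_Phi f a b) = hol_cfun f [tuple a; b].
Proof. by rewrite /underlying /= hol_qact_1 invg1 mulg1 !mul1g. Qed.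

End Vectors.

Theorem theorem5p4 (G N : groupType) :
  (forall (p : nat) (c : cochain G N p),
     (p <= 2)%N -> is_cocycle c -> integrable c)
  /\
  (forall f : cochain G N 2, is_cocycle f ->
     exists inv : ext f -> ext f,
     [/\ is_group_extension (@ext_mul G N f) (1, 1) inv
           (@ext_incl G N f) (@ext_proj G N f),
         (forall (g : G) (n : hol f),
            ext_incl (hol_qact g n) =
            ext_mul (ext_mul (ext_sec f g) (ext_incl n)) (inv (ext_sec f g)))
       & (forall a b : G,
            ext_incl (hol_cfun f [tuple a; b]) =
            ext_mul (ext_mul (ext_sec f a) (ext_sec f b))
                    (inv (ext_sec f (a * b))))])
  /\
  (forall f : cochain G N 2, is_cocycle f ->
     [/\ is_monoidal_category (Er f),
         is_strict (Er f),
         is_monoidal_functor (C := BG G) (D := Er f) (F := ext_sec f)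
           (@sec_hom G N f) (@sec_Phi G N f)
       & (forall a b : G,
            underlying (sec_Phi f a b) = hol_cfun f [tuple a; b])]).
Proof.
split; first exact: cocycle_integrable.
split=> f fZ.
  exists (@ext_inv G N f); split.
  - exact: ext_is_group_extension.
  - exact: ext_sec_conj.
  - exact: ext_sec_delta.
split.
- exact: Er_monoidal.
- exact: Er_strict.
- exact: sec_monoidal_functor.
- exact: sec_Phi_underlying.
Qed.
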